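(* Let $q\in(0,1)$ and let $N>1$ be an integer. Let $\mathcal O(C^N_q)$ be the coordinate algebra of the quantum cone, viewed as a subalgebra of the quantum disc algebra $\mathcal O(D_q)$. Let $\nu$ be the degree-counting automorphism and let $H=H_+\oplus H_-$, $\pi$, $D$, $J$ and $\gamma$ be as defined in the context. Then $(\mathcal O(C^N_q),H,D)$ is an (algebraic) even spectral triple of KO-dimension two with $\nu$-twisted real structure $J$ and grading $\gamma$.
   Context: **Algebraic $\nu$-twisted real structure.** Let $A$ be a complex $*$-algebra, $(H,\pi)$ a representation of $A$ on a complex vector space $H$, $D$ a linear operator on $H$, and $\nu$ a linear automorphism of $H$. Set $\bar\nu(\phi):=\nu\circ\phi\circ\nu^{-1}$ for $\phi\in\mathrm{End}(H)$, and assume there is an algebra automorphism $\hat\nu:A\to A$ with $\pi\circ\hat\nu=\bar\nu\circ\pi$. The triple $(A,H,D)$ admits a $\nu$-twisted real structure $J$ if $J:H\to H$ is an anti-linear map such that, for some signs $\epsilon,\epsilon'\in\{+,-\}$ and all $a,b\in A$: - $J^2=\epsilon\,\mathrm{id}$; - $[\pi(a),J\pi(b)J^{-1}]=0$; - $[D,\pi(a)]\,J\bar\nu^2(\pi(b))J^{-1}=J\pi(b)J^{-1}[D,\pi(a)]$; - $DJ\nu=\epsilon'\,\nu JD$; - $\nu J\nu=J$. It is even with grading $\gamma:H\to H$ if $\gamma^2=\mathrm{id}$, $[\gamma,\pi(a)]=0$ for all $a\in A$, $\gamma D=-D\gamma$, $\nu^2\gamma=\gamma\nu^2$, and $\gamma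 J=\epsilon''J\gamma$ for a sign $\epsilon''$. The signs determine the KO-dimension modulo 8 in the usual way; KO-dimension two means $(\epsilon,\epsilon',\epsilon'')=(-,+,-)$. ''Algebraic'' means that only these algebraic conditions are required (no Hilbert space or analytic conditions). **Quantum disc.** $\mathcal O(D_q)$ is the complex $*$-algebra generated by $z$ subject to $z^*z-q^2zz^*=1-q^2$. It is $\mathbb Z$-graded, $\mathcal O(D_q)=\bigoplus_{n\in\mathbb Z}\mathcal O(D_q)_n$, with degrees $|z|=1$, $|z^*|=-1$. **Quantum cone.** $\mathcal O(C^N_q)$ is the $*$-algebra generated by $y$ and self-adjoint $x$ subject to $$xy=q^{2N}yx,\qquad yy^*=\prod_{l=0}^{N-1}(1-q^{-2l}x),\qquad y^*y=\prod_{l=1}^{N}(1-q^{2l}x).$$ Via $x\mapsto 1-zz^*$, $y\mapsto z^N$ it is identified with the $*$-subalgebra $\bigoplus_{n\in\mathbb Z}\mathcal O(D_q)_{nN}$ of $\mathcal O(D_q)$. **Automorphism $\nu$.** $\nu:\mathcal O(D_q)\to\mathcal O(D_q)$ is the algebra automorphism $\nu(a)=q^{|a|}a$ on homogeneous elements. **Skew derivations.** $\partial_\pm:\mathcal O(D_q)\to\mathcal O(D_q)$ are the linear maps with $$\partial_-(z)=z^*,\quad \partial_-(z^* )=0,\quad \partial_+(z)=0,\quad \partial_+(z^* )=q^2z,$$ extended by the twisted Leibniz rule $\partial_\pm(ab)=\partial_\pm(a)\nu^2(b)+a\,\partial_\pm(b)$ for all $a,b\in\mathcal O(D_q)$. They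 have degrees $\pm2$ respectively. **The data.** Set $$H_+=\bigoplus_{n\in\mathbb Z}\mathcal O(D_q)_{nN+1},\qquad H_-=\bigoplus_{n\in\mathbb Z}\mathcal O(D_q)_{nN-1},\qquad H=H_+\oplus H_-$$ (external direct sum of vector spaces), so that $\partial_\pm(H_\mp)\subseteq H_\pm$ and $*$ exchanges $H_+$ and $H_-$. The representation $\pi$ of $\mathcal O(C^N_q)$ on $H$ is $\pi(a)(h_\pm)=\nu^2(a)h_\pm$ for $h_\pm\in H_\pm$ (multiplication in $\mathcal O(D_q)$). The automorphism $\nu$ of $\mathcal O(D_q)$ restricts to $H_+$ and $H_-$ and so induces a linear automorphism of $H$, also denoted $\nu$. The operators $D,J,\gamma:H\to H$ are $$D(h_+,h_-)=\big(-q^{-1}\partial_+(h_-),\ q\,\partial_-(h_+)\big),\quad J(h_+,h_-)=(-h_-^*,\,h_+^* ),\quad \gamma(h_+,h_-)=(h_+,-h_-).$$ *)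

(* Defs.v *)
From HB Require Import structures.
From mathcomp Require Import all_boot all_order all_algebra.
From mathcomp Require Import complex.
From mathcomp Require Import boolp classical_sets reals.

Set Implicit Arguments.
Unset Strict Implicit.
Unset Printing Implicit Defensive.
Import Order.TTheory GRing.Theory Num.Theory.
Local Open Scope ring_scope.
Local Open Scope quotient_scope.

HB.mixin Record hasStar (C : numClosedFieldType) A of GRing.Algebra C A := {
  star : A -> A;
  starK : involutive star;
  starD : {morph star : a b / a + b};
  starZ : forall (c : C) (a : A), star (c *: a) = c^* *: star a;
  starM : forall a b : A, star (a * b) = star b * star a
}.

#[short(type="starAlgType")]
HB.structure Definition StarAlgebra (C : numClosedFieldType) :=
  { A of GRing.Algebra C A & hasStar C A }.

Section StarTheory.
Variables (C : numClosedFieldType) (A : starAlgType C).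

Lemma star0 : star (0 : A) = 0.
Proof. by rewrite -[X in star X](scale0r (0 : A)) starZ conjC0 scale0r. Qed.

Lemma star1 : star (1 : A) = 1.
Proof. by rewrite -[RHS]starK -{2}[star 1]mulr1 starM starK mulr1. Qed.

Lemma starN (a : A) : star (- a) = - star a.
Proof. by rewrite -scaleN1r starZ rmorphN1 scaleN1r. Qed.

Lemma starB (a b : A) : star (a - b) = star a - star b.
Proof. by rewrite starD starN. Qed.

Lemma starX (a : A) n : star (a ^+ n) = star a ^+ n.
Proof. by elim: n => [|n IHn]; rewrite ?star1 // exprS starM IHn exprSr. Qed.

End StarTheory.

Section Terms.
Variables (C : numClosedFieldType) (X : Type).

(* Expressions over the letters [TGen x false], standing for x, and
   [TGen x true], standing for x^*. *)
Inductive term :=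
  | TGen of X & bool
  | TConst of C
  | TAdd of term & term
  | TMul of term & term.

Definition tsub s t := TAdd s (TMul (TConst (-1)) t).
Definition tprod (s : seq term) := foldr TMul (TConst 1) s.

Fixpoint tstar t :=
  match t with
  | TGen x b => TGen x (~~ b)
  | TConst c => TConst c^*
  | TAdd s t => TAdd (tstar s) (tstar t)
  | TMul s t => TMul (tstar t) (tstar s)
  end.

Lemma tstarK : involutive tstar.
Proof.
by elim=> [x b|c|s IHs t IHt|s IHs t IHt] /=; rewrite ?negbK ?conjCK ?IHs ?IHt.
Qed.

(* The smallest congruence containing [rel], closed under [tstar], whose
   quotient is an associative unital C-algebra. *)
Inductive cong (rel : term -> term -> Prop) : term -> term -> Prop :=
  | cong_refl t : cong rel t t
  | cong_sym s t : cong rel s t -> cong rel t s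
  | cong_trans s t u : cong rel s t -> cong rel t u -> cong rel s u
  | cong_add s s' t t' :
      cong rel s s' -> cong rel t t' -> cong rel (TAdd s t) (TAdd s' t')
  | cong_mul s s' t t' :
      cong rel s s' -> cong rel t t' -> cong rel (TMul s t) (TMul s' t')
  | cong_addA s t u : cong rel (TAdd s (TAdd t u)) (TAdd (TAdd s t) u)
  | cong_addC s t : cong rel (TAdd s t) (TAdd t s)
  | cong_add0 t : cong rel (TAdd (TConst 0) t) t
  | cong_mulA s t u : cong rel (TMul s (TMul t u)) (TMul (TMul s t) u)
  | cong_mul1 t : cong rel (TMul (TConst 1) t) t
  | cong_mul0 t : cong rel (TMul (TConst 0) t) (TConst 0)
  | cong_mulDl s t u : cong rel (TMul (TAdd s t) u) (TAdd (TMul s u) (TMul t u))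
  | cong_mulDr s t u : cong rel (TMul s (TAdd t u)) (TAdd (TMul s t) (TMul s u))
  | cong_constD c d : cong rel (TConst (c + d)) (TAdd (TConst c) (TConst d))
  | cong_constM c d : cong rel (TConst (c * d)) (TMul (TConst c) (TConst d))
  | cong_constC c t : cong rel (TMul (TConst c) t) (TMul t (TConst c))
  | cong_rel s t : rel s t -> cong rel s t
  | cong_rel_star s t : rel s t -> cong rel (tstar s) (tstar t).

Lemma cong_tstar rel s t : cong rel s t -> cong rel (tstar s) (tstar t).
Proof.
elim=> {s t} /=.
- by move=> t; apply: cong_refl.
- by move=> s t _; apply: cong_sym.
- by move=> s t u _ IH1 _ IH2; apply: cong_trans IH1 IH2.
- by move=> *; apply: cong_add.
- by move=> *; apply: cong_mul.
- by move=> *; apply: cong_addA.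
- by move=> *; apply: cong_addC.
- by move=> t; rewrite rmorph0; apply: cong_add0.
- by move=> s t u; apply/cong_sym/cong_mulA.
- move=> t; rewrite rmorph1.
  by apply: cong_trans (cong_mul1 _ _); apply/cong_sym/cong_constC.
- move=> t; rewrite rmorph0.
  by apply: cong_trans (cong_mul0 _ (tstar t)); apply/cong_sym/cong_constC.
- by move=> *; apply: cong_mulDr.
- by move=> *; apply: cong_mulDl.
- by move=> c d; rewrite rmorphD; apply: cong_constD.
- by move=> c d; rewrite rmorphM mulrC; apply: cong_constM.
- by move=> c t; apply/cong_sym/cong_constC.
- by move=> s t rst; apply: cong_rel_star.
- by move=> s t rst; rewrite !tstarK; apply: cong_rel.
Qed.

HB.instance Definition _ := gen_eqMixin term.
HB.instance Definition _ := gen_choiceMixin term.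

End Terms.

Arguments TGen {C X}.
Arguments TConst {C X}.

(* Generators and relations for a complex *-algebra; consistency (the quotient
   is not the zero ring) is part of the data because the algebras of the library
   are nontrivial. *)
Record presentation (C : numClosedFieldType) := Presentation {
  gens : Type;
  rels : term C gens -> term C gens -> Prop;
  consistent : ~ cong rels (TConst 1) (TConst 0)
}.

Section Presented.
Variables (C : numClosedFieldType) (P : presentation C).
Local Notation T := (term C (gens P)).
Local Notation "s ~~> t" := (cong (@rels _ P) s t) (at level 70).

Definition congb : rel T := fun s t => `[< s ~~> t >].

Lemma congb_equiv : equiv_class_of congb.
Proof.
split.
- by move=> t; apply/asboolP/cong_refl.
- by move=> s t; apply/asboolP/asboolP => /cong_sym.
- by move=> t s u /asboolP st /asboolP tu; apply/asboolP/(cong_trans st tu).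
Qed.

Canonical congb_equivRel := EquivRelPack congb_equiv.

Definition presented := {eq_quot congb_equivRel}.

HB.instance Definition _ := EqQuotient.on presented.
HB.instance Definition _ := Choice.on presented.

Definition cls (t : T) : presented := \pi_presented t.

Lemma clsP s t : cls s = cls t <-> s ~~> t.
Proof.
split; first by move/eqquotP/asboolP.
by move=> st; apply/eqquotP/asboolP.
Qed.

Lemma cls_repr a : cls (repr a) = a.
Proof. exact: reprK. Qed.

Lemma repr_cls t : repr (cls t) ~~> t.
Proof. by apply/clsP; rewrite cls_repr. Qed.

Definition padd (a b : presented) := cls (TAdd (repr a) (repr b)).
Definition popp (a : presented) := cls (TMul (TConst (-1)) (repr a)).
Definition pmul (a b : presented) := cls (TMul (repr a) (repr b)).
Definition pscale (c : C) (a : presented) := cls (TMul (TConst c) (repr a)).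
Definition pstar (a : presented) := cls (tstar (repr a)).

Lemma paddE s t : padd (cls s) (cls t) = cls (TAdd s t).
Proof. by apply/clsP/cong_add; apply: repr_cls. Qed.

Lemma poppE t : popp (cls t) = cls (TMul (TConst (-1)) t).
Proof. by apply/clsP/cong_mul; [apply: cong_refl|apply: repr_cls]. Qed.

Lemma pmulE s t : pmul (cls s) (cls t) = cls (TMul s t).
Proof. by apply/clsP/cong_mul; apply: repr_cls. Qed.

Lemma pscaleE c t : pscale c (cls t) = cls (TMul (TConst c) t).
Proof. by apply/clsP/cong_mul; [apply: cong_refl|apply: repr_cls]. Qed.

Lemma pstarE t : pstar (cls t) = cls (tstar t).
Proof. by apply/clsP/cong_tstar/repr_cls. Qed.

Lemma clsW (Q : presented -> Prop) : (forall t, Q (cls t)) -> forall a, Q a.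
Proof. by move=> Qc a; rewrite -[a]cls_repr. Qed.

Lemma paddA : associative padd.
Proof.
elim/clsW=> s; elim/clsW=> t; elim/clsW=> u; rewrite !paddE.
exact/clsP/cong_addA.
Qed.

Lemma paddC : commutative padd.
Proof.
by elim/clsW=> s; elim/clsW=> t; rewrite !paddE; apply/clsP/cong_addC.
Qed.

Lemma padd0 : left_id (cls (TConst 0)) padd.
Proof. by elim/clsW=> s; rewrite paddE; apply/clsP/cong_add0. Qed.

Lemma paddN : left_inverse (cls (TConst 0)) popp padd.
Proof.
elim/clsW=> s; rewrite poppE paddE; apply/clsP.
apply: cong_trans (cong_mul0 _ s).
apply: cong_sym; rewrite -[X in TMul (TConst X) s](addNr (1 : C)).
apply: cong_trans (cong_mul (cong_constD _ _ _) (cong_refl _ _)) _.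
apply: cong_trans (cong_mulDl _ _ _ _) _.
by apply: cong_add; [apply: cong_refl|apply: cong_mul1].
Qed.

HB.instance Definition _ :=
  GRing.isZmodule.Build presented paddA paddC padd0 paddN.

Lemma clsD s t : cls (TAdd s t) = cls s + cls t.
Proof. by rewrite [RHS]paddE. Qed.

Lemma pmulA : associative pmul.
Proof.
elim/clsW=> s; elim/clsW=> t; elim/clsW=> u; rewrite !pmulE.
exact/clsP/cong_mulA.
Qed.

Lemma pmul1 : left_id (cls (TConst 1)) pmul.
Proof. by elim/clsW=> s; rewrite pmulE; apply/clsP/cong_mul1. Qed.

Lemma pmulr1 : right_id (cls (TConst 1)) pmul.
Proof.
elim/clsW=> s; rewrite pmulE; apply/clsP.
by apply: cong_trans (cong_mul1 _ s); apply/cong_sym/cong_constC.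
Qed.

Lemma pmulDl : left_distributive pmul padd.
Proof.
elim/clsW=> s; elim/clsW=> t; elim/clsW=> u; rewrite !(paddE, pmulE).
exact/clsP/cong_mulDl.
Qed.

Lemma pmulDr : right_distributive pmul padd.
Proof.
elim/clsW=> s; elim/clsW=> t; elim/clsW=> u; rewrite !(paddE, pmulE).
exact/clsP/cong_mulDr.
Qed.

Lemma pone_neq0 : cls (TConst 1) != 0.
Proof. by apply/eqP => /clsP; apply: consistent. Qed.

HB.instance Definition _ := GRing.Zmodule_isNzRing.Build presented
  pmulA pmul1 pmulr1 pmulDl pmulDr pone_neq0.

Lemma clsM s t : cls (TMul s t) = cls s * cls t.
Proof. by rewrite [RHS]pmulE. Qed.

Lemma pscaleA c d a : pscale c (pscale d a) = pscale (c * d) a.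
Proof.
elim/clsW: a => s; rewrite !pscaleE; apply/clsP.
apply: cong_trans (cong_mulA _ _ _ _) _.
by apply: cong_mul; [apply/cong_sym/cong_constM|apply: cong_refl].
Qed.

Lemma pscale1 : left_id 1 pscale.
Proof. by elim/clsW=> s; rewrite pscaleE; apply/clsP/cong_mul1. Qed.

Lemma pscaleDr : right_distributive pscale +%R.
Proof.
move=> c; elim/clsW=> s; elim/clsW=> t.
rewrite -clsD !pscaleE -clsD.
exact/clsP/cong_mulDr.
Qed.

Lemma pscaleDl a : {morph pscale^~ a : c d / c + d}.
Proof.
elim/clsW: a => s c d; rewrite !pscaleE -clsD; apply/clsP.
apply: cong_trans (cong_mul (cong_constD _ _ _) (cong_refl _ _)) _.
exact: cong_mulDl.
Qed.

HB.instance Definition _ := GRing.Zmodule_isLmodule.Build C presented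
  pscaleA pscale1 pscaleDr pscaleDl.

Lemma clsZ c t : cls (TMul (TConst c) t) = c *: cls t.
Proof. by rewrite [RHS]pscaleE. Qed.

Lemma pscaleAl (c : C) (a b : presented) : c *: (a * b) = (c *: a) * b.
Proof.
elim/clsW: a => s; elim/clsW: b => t.
rewrite -clsM -!clsZ -clsM.
exact/clsP/cong_mulA.
Qed.

HB.instance Definition _ := GRing.Lmodule_isLalgebra.Build C presented pscaleAl.

Lemma pscaleAr (c : C) (a b : presented) : c *: (a * b) = a * (c *: b).
Proof.
elim/clsW: a => s; elim/clsW: b => t.
rewrite -clsM -!clsZ -clsM; apply/clsP.
apply: cong_trans (cong_mulA _ _ _ _) _.
apply: cong_trans _ (cong_sym (cong_mulA _ _ _ _)).
by apply: cong_mul; [apply: cong_constC|apply: cong_refl].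
Qed.

HB.instance Definition _ := GRing.Lalgebra_isAlgebra.Build C presented pscaleAr.

Lemma pstarK : involutive pstar.
Proof. by elim/clsW=> s; rewrite !pstarE tstarK. Qed.

Lemma pstarD : {morph pstar : a b / a + b}.
Proof.
elim/clsW=> s; elim/clsW=> t.
by rewrite -clsD !pstarE -clsD.
Qed.

Lemma pstarZ (c : C) (a : presented) : pstar (c *: a) = c^* *: pstar a.
Proof.
elim/clsW: a => s; rewrite -clsZ !pstarE -clsZ.
exact/clsP/cong_sym/cong_constC.
Qed.

Lemma pstarM (a b : presented) : pstar (a * b) = pstar b * pstar a.
Proof.
elim/clsW: a => s; elim/clsW: b => t.
by rewrite -clsM !pstarE -clsM.
Qed.

HB.instance Definition _ :=
  hasStar.Build C presented pstarK pstarD pstarZ pstarM.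

Definition gen (x : gens P) : presented := cls (TGen x false).

Lemma cls_gen x b : cls (TGen x b) = if b then star (gen x) else gen x.
Proof. by case: b => //; rewrite [RHS]pstarE. Qed.

Lemma cls_const c : cls (TConst c) = c%:A.
Proof.
by rewrite -clsZ clsM [_ * _]pmulr1.
Qed.

End Presented.

Section Evaluation.
Variables (C : numClosedFieldType) (X : Type).
Variables (B : algType C) (g : X -> bool -> B).

Fixpoint teval (t : term C X) : B :=
  match t with
  | TGen x b => g x b
  | TConst c => c%:A
  | TAdd s t => teval s + teval t
  | TMul s t => teval s * teval t
  end.

Lemma teval_sub s t : teval (tsub s t) = teval s - teval t.
Proof. by rewrite /= -scalerAl mul1r scaleN1r. Qed.

Lemma teval_prod s : teval (tprod s) = \prod_(t <- s) teval t.
Proof.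
by elim: s => [|t s IHs] /=; rewrite ?big_nil ?big_cons ?IHs ?scale1r.
Qed.

Lemma teval_cong rel :
  (forall s t, rel s t -> teval s = teval t) ->
  (forall s t, rel s t -> teval (tstar s) = teval (tstar t)) ->
  forall s t, cong rel s t -> teval s = teval t.
Proof.
move=> gr gr' s t; elim=> {s t} //=.
- by move=> s t u _ -> _ ->.
- by move=> s s' t t' _ -> _ ->.
- by move=> s s' t t' _ -> _ ->.
- by move=> s t u; rewrite addrA.
- by move=> s t; rewrite addrC.
- by move=> t; rewrite scale0r add0r.
- by move=> s t u; rewrite mulrA.
- by move=> t; rewrite scale1r mul1r.
- by move=> t; rewrite scale0r mul0r.
- by move=> s t u; rewrite mulrDl.
- by move=> s t u; rewrite mulrDr.
- by move=> c d; rewrite scalerDl.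
- by move=> c d; rewrite -scalerAl mul1r scalerA.
- by move=> c t; rewrite -scalerAl mul1r -scalerAr mulr1.
Qed.

End Evaluation.

Section Lift.
Variables (C : numClosedFieldType) (P : presentation C) (B : algType C).
Variable g : gens P -> bool -> B.
Hypothesis gr : forall s t, rels s t -> teval g s = teval g t.
Hypothesis gr' : forall s t, rels s t -> teval g (tstar s) = teval g (tstar t).

Definition lift (a : presented P) : B := teval g (repr a).

Lemma lift_cls t : lift (cls t) = teval g t.
Proof. exact: (teval_cong gr gr' (repr_cls t)). Qed.

Lemma liftD : {morph lift : a b / a + b}.
Proof.
by elim/clsW=> s; elim/clsW=> t; rewrite -clsD !lift_cls.
Qed.

Lemma liftM : {morph lift : a b / a * b}.
Proof.
by elim/clsW=> s; elim/clsW=> t; rewrite -clsM !lift_cls.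
Qed.

Lemma liftZ (c : C) a : lift (c *: a) = c *: lift a.
Proof.
by elim/clsW: a => s; rewrite -clsZ !lift_cls /= -scalerAl mul1r.
Qed.

Lemma lift1 : lift 1 = 1.
Proof. by rewrite [lift _]lift_cls /= scale1r. Qed.

Lemma lift_gen x : lift (gen x) = g x false.
Proof. exact: lift_cls. Qed.

Lemma lift_gen_star x : lift (star (gen x)) = g x true.
Proof. by rewrite -(cls_gen x true) lift_cls. Qed.

End Lift.

Section StarLift.
Variables (C : numClosedFieldType) (X : Type) (B : starAlgType C).

Definition star_letters (f : X -> B) (x : X) (b : bool) :=
  if b then star (f x) else f x.

Lemma teval_star (f : X -> B) t :
  teval (star_letters f) (tstar t) = star (teval (star_letters f) t).
Proof.
elim: t => [x []|c|s IHs t IHt|s IHs t IHt] //=.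
- by rewrite starK.
- by rewrite starZ star1.
- by rewrite starD IHs IHt.
- by rewrite starM IHs IHt.
Qed.

End StarLift.

Section Disc.
Variables (R : realType) (q : R).
Local Notation C := R[i].
Local Notation "r %:C" := (real_complex R r).

Lemma conj_real (r : R) : (r%:C)^* = r%:C.
Proof. by apply/CrealP; rewrite complex_real. Qed.

Local Notation tz := (TGen tt false).
Local Notation tz' := (TGen tt true).

Variant disc_rel : term C unit -> term C unit -> Prop :=
  | DiscRel :
      disc_rel (tsub (TMul tz' tz) (TMul (TConst (q ^+ 2)%:C) (TMul tz tz')))
               (TConst (1 - q ^+ 2)%:C).

Lemma disc_consistent : ~ cong disc_rel (TConst 1) (TConst 0).
Proof.
pose g (_ : unit) (_ : bool) : C^o := 1.
have gr s t : disc_rel s t -> teval g s = teval g t.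
  by case; rewrite teval_sub /= !mulr1 rmorphB rmorph1 scalerBl scale1r.
have gr' s t : disc_rel s t -> teval g (tstar s) = teval g (tstar t).
  case; rewrite /= !conj_real rmorphN1 !mul1r scaleN1r mulrN mulr1.
  by rewrite rmorphB rmorph1 scalerBl scale1r.
move=> /(teval_cong gr gr') /=; rewrite scale1r scale0r.
by move/eqP; rewrite oner_eq0.
Qed.

Definition disc_presentation := Presentation disc_consistent.
Definition disc := presented disc_presentation.
HB.instance Definition _ := StarAlgebra.on disc.

Definition disc_z : disc := gen (tt : gens disc_presentation).
Local Notation z := disc_z.

Lemma disc_eq : star z * z - (q ^+ 2)%:C *: (z * star z) = (1 - q ^+ 2)%:C%:A.
Proof.
rewrite -cls_const -(cls_gen (tt : gens disc_presentation) true).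
rewrite -!clsM -clsZ -scaleN1r -clsZ -clsD.
exact/clsP/cong_rel/DiscRel.
Qed.

End Disc.

Section DiscInd.
Variables (R : realType) (q : R).
Local Notation C := R[i].
Local Notation "r %:C" := (real_complex R r).
Local Notation z := (disc_z q).

Lemma disc_teval (B : algType C) (u v : B) :
  v * u - (q ^+ 2)%:C *: (u * v) = (1 - q ^+ 2)%:C%:A ->
  let g (_ : unit) (b : bool) := if b then v else u in
  (forall s t, disc_rel q s t -> teval g s = teval g t) /\
  (forall s t, disc_rel q s t -> teval g (tstar s) = teval g (tstar t)).
Proof.
move=> uv g; split=> s t []; rewrite -[RHS]/(_%:A).
  by rewrite teval_sub /= -scalerAl mul1r.
by rewrite /= !conj_real rmorphN1 -!scalerAr !mulr1 scaleN1r.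
Qed.

Lemma clsz : cls (TGen (tt : gens (disc_presentation q)) false) = z.
Proof. by []. Qed.

Lemma clsz' : cls (TGen (tt : gens (disc_presentation q)) true) = star z.
Proof. exact: (cls_gen (tt : gens (disc_presentation q)) true). Qed.

Lemma disc_ind (Q : disc q -> Prop) :
  Q z -> Q (star z) -> (forall c : C, Q c%:A) ->
  (forall a b, Q a -> Q b -> Q (a + b)) ->
  (forall a b, Q a -> Q b -> Q (a * b)) -> forall a, Q a.
Proof.
move=> Qz Qz' Qc QD QM; apply: clsW.
elim=> [[] []|c|s IHs t IHt|s IHs t IHt].
- by rewrite clsz'.
- by rewrite clsz.
- by rewrite cls_const.
- by rewrite clsD; apply: QD.
- by rewrite clsM; apply: QM.
Qed.

(* Monomials in z and z^*: the letter [false] is z, the letter [true] is z^*. *)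
Definition letter (b : bool) : disc q := if b then star z else z.
Definition word (w : seq bool) : disc q := \prod_(b <- w) letter b.
Definition ldeg (b : bool) : int := if b then -1 else 1.
Definition wdeg (w : seq bool) : int := \sum_(b <- w) ldeg b.

(* The component of degree n: linear combinations of monomials of degree n. *)
Definition homog (n : int) : set (disc q) :=
  [set a | exists2 s : seq (C * seq bool), all (fun p => wdeg p.2 == n) s
         & a = \sum_(p <- s) p.1 *: word p.2].

(* Finite sums of elements of the subspaces V n. *)
Definition sum_of (V : int -> set (disc q)) : set (disc q) :=
  [set a | exists2 s : seq (int * disc q), (forall p, p \in s -> V p.1 p.2)
         & a = \sum_(p <- s) p.2].

Lemma homog0 n : homog n 0.
Proof. by exists [::]; rewrite ?big_nil. Qed.

Lemma homogD n a b : homog n a -> homog n b -> homog n (a + b).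
Proof.
move=> [s ns ->] [t nt ->]; exists (s ++ t); first by rewrite all_cat ns nt.
by rewrite big_cat.
Qed.

Lemma homogZ n (c : C) a : homog n a -> homog n (c *: a).
Proof.
move=> [s ns ->]; exists [seq (c * p.1, p.2) | p <- s].
  by rewrite all_map; apply: sub_all ns.
by rewrite big_map scaler_sumr; apply: eq_bigr => p _; rewrite scalerA.
Qed.

Lemma homog_word w : homog (wdeg w) (word w).
Proof.
by exists [:: (1, w)]; rewrite /= ?eqxx // big_seq1 scale1r.
Qed.

Lemma homog_sum (I : eqType) n (s : seq I) (F : I -> disc q) :
  (forall i, i \in s -> homog n (F i)) -> homog n (\sum_(i <- s) F i).
Proof.
elim: s => [|i s IHs] Fs; first by rewrite big_nil; apply: homog0.
rewrite big_cons; apply: homogD; first by apply: Fs; rewrite mem_head.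
by apply: IHs => j js; apply: Fs; rewrite in_cons js orbT.
Qed.

(* A linear map is controlled on homog n by its values on words. *)
Lemma homog_map (n m : int) (f : disc q -> disc q) :
  f 0 = 0 -> {morph f : a b / a + b} ->
  (forall (c : C) a, homog m (f a) -> homog m (f (c *: a))) ->
  (forall w, wdeg w = n -> homog m (f (word w))) ->
  forall a, homog n a -> homog m (f a).
Proof.
move=> f0 fD fZ fw a [s ns ->]; rewrite (big_morph f fD f0).
by apply: homog_sum => p /(allP ns) /eqP /fw; apply: fZ.
Qed.

Lemma word_cat u v : word (u ++ v) = word u * word v.
Proof. by rewrite /word big_cat. Qed.

Lemma wdeg_cat u v : wdeg (u ++ v) = wdeg u + wdeg v.
Proof. by rewrite /wdeg big_cat. Qed.

Lemma homogM m n a b : homog m a -> homog n b -> homog (m + n) (a * b).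
Proof.
move=> ha [t nt ->]; rewrite mulr_sumr; apply: homog_sum => p /(allP nt)/eqP <-.
rewrite -scalerAr; apply: homogZ.
apply: (@homog_map m _ (fun x => x * word p.2) _ _ _ _ a ha)
  => [|x y|c x h|w <-]; rewrite ?mul0r ?mulrDl //.
  by rewrite -scalerAl; apply: homogZ.
by rewrite -word_cat -wdeg_cat; apply: homog_word.
Qed.

Lemma homog_letter b : homog (ldeg b) (letter b).
Proof.
have := homog_word [:: b].
by rewrite /word /wdeg !big_seq1.
Qed.

Lemma homog1 : homog 0 1.
Proof. by have := homog_word [::]; rewrite /word /wdeg !big_nil. Qed.

Lemma wdeg_rev w : wdeg (map negb (rev w)) = - wdeg w.
Proof.
elim: w => [|b w IHw]; first by rewrite /wdeg !big_nil oppr0.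
rewrite rev_cons map_rcons -cats1 wdeg_cat IHw -[b :: w]cat1s wdeg_cat.
rewrite opprD addrC.
by congr (_ + _); rewrite /wdeg !big_seq1; case: b.
Qed.

Lemma star_word w : star (word w) = word (map negb (rev w)).
Proof.
elim: w => [|b w IHw]; first by rewrite /word !big_nil star1.
rewrite rev_cons map_rcons -cats1 -[b :: w]cat1s !word_cat starM IHw.
congr (_ * _).
by rewrite /word !big_seq1; case: b => //=; rewrite starK.
Qed.

Lemma homog_star n a : homog n a -> homog (- n) (star a).
Proof.
apply: homog_map; first exact: star0.
- exact: starD.
- by move=> c x h; rewrite starZ; apply: homogZ.
- by move=> w <-; rewrite star_word -wdeg_rev; apply: homog_word.
Qed.

Lemma sum_of0 V : sum_of V 0.
Proof. by exists [::]; rewrite ?big_nil. Qed.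

Lemma sum_ofD V a b : sum_of V a -> sum_of V b -> sum_of V (a + b).
Proof.
move=> [s Vs ->] [t Vt ->]; exists (s ++ t); last by rewrite big_cat.
by move=> p; rewrite mem_cat => /orP[/Vs|/Vt].
Qed.

Lemma sum_of_in V n a : V n a -> sum_of V a.
Proof.
move=> Va; exists [:: (n, a)]; last by rewrite big_seq1.
by move=> p; rewrite inE => /eqP ->.
Qed.

Lemma sum_of_map V W (f : disc q -> disc q) :
  f 0 = 0 -> {morph f : a b / a + b} ->
  (forall n a, V n a -> sum_of W (f a)) ->
  forall a, sum_of V a -> sum_of W (f a).
Proof.
move=> f0 fD fV a [s + ->]; rewrite (big_morph f fD f0).
elim: s => [|p s IHs] Vs; first by rewrite big_nil; apply: sum_of0.
rewrite big_cons; apply: sum_ofD; first by apply: (fV p.1); apply/Vs/mem_head.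
by apply: IHs => r rs; apply: Vs; rewrite in_cons rs orbT.
Qed.

End DiscInd.

Section Twist.
Variables (R : realType) (q : R) (hq : 0 < q < 1).
Local Notation C := R[i].
Local Notation "r %:C" := (real_complex R r).
Local Notation z := (disc_z q).

Lemma qC_neq0 : q%:C != 0.
Proof. by case/andP: hq => q0 _; rewrite fmorph_eq0 gt_eqF. Qed.

Definition nu_letter (_ : gens (disc_presentation q)) (b : bool) : disc q :=
  if b then (q^-1)%:C *: star z else q%:C *: z.

Lemma nu_rels :
  (forall s t, disc_rel q s t -> teval nu_letter s = teval nu_letter t) /\
  (forall s t, disc_rel q s t ->
     teval nu_letter (tstar s) = teval nu_letter (tstar t)).
Proof.
apply: (@disc_teval R q (disc q) (q%:C *: z) ((q^-1)%:C *: star z)).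
rewrite -!scalerAl -!scalerAr !scalerA fmorphV mulVf ?divff ?qC_neq0 //.
rewrite mulfK ?qC_neq0 // scale1r.
exact: disc_eq.
Qed.

(* Determined by z |-> q z and z^* |-> q^-1 z^*; [nu_homog] gives
   nu(a) = q^n a for a of degree n. *)
Definition nu : disc q -> disc q := lift nu_letter.

Lemma nu_cls t : nu (cls t) = teval nu_letter t.
Proof. by apply: lift_cls; case: nu_rels. Qed.

Lemma nuD : {morph nu : a b / a + b}.
Proof. by apply: liftD; case: nu_rels. Qed.

Lemma nuM : {morph nu : a b / a * b}.
Proof. by apply: liftM; case: nu_rels. Qed.

Lemma nuZ (c : C) a : nu (c *: a) = c *: nu a.
Proof. by apply: liftZ; case: nu_rels. Qed.

Lemma nu1 : nu 1 = 1.
Proof. by apply: lift1; case: nu_rels. Qed.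

Lemma nu0 : nu 0 = 0.
Proof. by rewrite -[X in nu X](scale0r (0 : disc q)) nuZ scale0r. Qed.

Lemma nu_z : nu z = q%:C *: z.
Proof. by apply: lift_gen; case: nu_rels. Qed.

Lemma nu_z' : nu (star z) = (q^-1)%:C *: star z.
Proof. by apply: lift_gen_star; case: nu_rels. Qed.

Lemma nu_homog n a : homog n a -> nu a = (q ^ n)%:C *: a.
Proof.
have q0 : q != 0 by have := qC_neq0; rewrite fmorph_eq0.
have nuw w : nu (word q w) = (q ^ wdeg w)%:C *: word q w.
  elim: w => [|b w IHw]; first by rewrite /word /wdeg !big_nil nu1 scale1r.
  rewrite -cat1s word_cat wdeg_cat nuM IHw expfzDr // rmorphM -scalerA.
  have -> : nu (word q [:: b]) = (q ^ wdeg [:: b])%:C *: word q [:: b].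
    by rewrite /word /wdeg !big_seq1; case: b; rewrite /= ?nu_z ?nu_z'.
  by rewrite -scalerAl -scalerAr.
move=> [s ns ->]; rewrite (big_morph nu nuD nu0) scaler_sumr.
rewrite big_seq [RHS]big_seq; apply: eq_bigr => p /(allP ns) /eqP pn.
by rewrite nuZ nuw pn !scalerA mulrC.
Qed.

(* The twisted Leibniz rule d(a b) = d(a) nu^2(b) + a d(b) as a recursion on
   expressions, where [d false] is the value at z and [d true] the value at z^*.
   It descends to the disc when d respects the defining relation ([skew_ok]). *)
Fixpoint tskew (d : bool -> disc q)
    (t : term C (gens (disc_presentation q))) : disc q :=
  match t with
  | TGen _ b => d b
  | TConst _ => 0
  | TAdd s t => tskew d s + tskew d t
  | TMul s t => tskew d s * nu (nu (cls t)) + cls s * tskew d t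
  end.

Definition skew_ok (d : bool -> disc q) :=
  d true * ((q ^+ 2)%:C *: z) + star z * d false =
  (q ^+ 2)%:C *: (d false * ((q ^- 2)%:C *: star z) + z * d true).

Lemma nu2_z : nu (nu z) = (q ^+ 2)%:C *: z.
Proof. by rewrite !(nu_z, nuZ) scalerA rmorphXn. Qed.

Lemma nu2_z' : nu (nu (star z)) = (q ^- 2)%:C *: star z.
Proof.
by rewrite !(nu_z', nuZ) scalerA -rmorphM -invfM.
Qed.

Lemma nu_const (c : C) : nu c%:A = c%:A.
Proof. by rewrite nuZ nu1. Qed.

Lemma tskew_cong d : skew_ok d ->
  forall s t, cong (disc_rel q) s t -> tskew d s = tskew d t.
Proof.
move=> dok s t.
pose dcls : term C (gens (disc_presentation q)) -> disc q := @cls _ _.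
have E s1 t1 : cong (disc_rel q) s1 t1 -> dcls s1 = dcls t1.
  by move=> st; apply/clsP.
rewrite /dcls {dcls} in E.
elim=> {s t} //=.
- by move=> s t u _ -> _ ->.
- by move=> s s' t t' _ -> _ ->.
- by move=> s s' t t' /E -> -> /E -> ->.
- by move=> s t u; rewrite addrA.
- by move=> s t; rewrite addrC.
- by move=> t; rewrite add0r.
- move=> s t u; rewrite !clsM !nuM !mulrDl !mulrDr !mulrA.
  by rewrite -!addrA.
- by move=> t; rewrite cls_const scale1r mul0r mul1r add0r.
- by move=> t; rewrite cls_const scale0r !mul0r addr0.
- by move=> s t u; rewrite clsD !mulrDl addrACA.
- by move=> s t u; rewrite clsD !nuD !mulrDr addrACA.
- by rewrite addr0.
- by move=> c d'; rewrite !cls_const mul0r mulr0 addr0.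
- move=> c t; rewrite !cls_const !nu_const mul0r mulr0 addr0 add0r.
  by rewrite -scalerAl -scalerAr mul1r mulr1.
- move=> s t [] /=; rewrite !cls_const !clsz !clsz' !mul0r !add0r.
  by rewrite -!scalerAl !mul1r scaleN1r nu2_z nu2_z' dok subrr.
- move=> s t [] /=; rewrite !mulr0 !addr0.
  rewrite !cls_const !clsz !clsz' !nu_const !rmorphN1 !conj_real.
  rewrite -!scalerAr !mulr1 scaleN1r nu2_z nu2_z' dok.
  by rewrite subrr.
Qed.

Definition skew (d : bool -> disc q) (a : disc q) : disc q := tskew d (repr a).

Section SkewTheory.
Variables (d : bool -> disc q) (dok : skew_ok d).

Lemma skew_cls t : skew d (cls t) = tskew d t.
Proof. exact/(tskew_cong dok)/(repr_cls t). Qed.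

Lemma skewD : {morph skew d : a b / a + b}.
Proof. by elim/clsW=> s; elim/clsW=> t; rewrite -clsD !skew_cls. Qed.

Lemma skew_const (c : C) : skew d c%:A = 0.
Proof. by rewrite -cls_const skew_cls. Qed.

Lemma skewM a b : skew d (a * b) = skew d a * nu (nu b) + a * skew d b.
Proof. by elim/clsW: a => s; elim/clsW: b => t; rewrite -clsM !skew_cls. Qed.

Lemma skewZ (c : C) a : skew d (c *: a) = c *: skew d a.
Proof. by rewrite -mulr_algl skewM skew_const mul0r add0r mulr_algl. Qed.

Lemma skew0 : skew d 0 = 0.
Proof. by rewrite -[X in skew _ X](scale0r (0 : disc q)) skewZ scale0r. Qed.

Lemma skew_letter b : skew d (letter q b) = d b.
Proof. by case: b; rewrite /= -?clsz -?clsz' skew_cls. Qed.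

Lemma skew_homog (e n : int) a : (forall b, homog (ldeg b + e) (d b)) ->
  homog n a -> homog (n + e) (skew d a).
Proof.
move=> de; apply: homog_map => [||c x h|w <-].
- exact: skew0.
- exact: skewD.
- by rewrite skewZ; apply: homogZ.
have nu2 n' x : homog n' x -> homog n' (nu (nu x)).
  by move=> hx; rewrite !(nu_homog hx, nuZ); do 2!apply: homogZ.
elim: w => [|b w IHw].
  rewrite /word big_nil -(scale1r 1) skew_const; exact: homog0.
rewrite -cat1s word_cat wdeg_cat skewM.
have -> : word q [:: b] = letter q b by rewrite /word big_seq1.
have -> : wdeg [:: b] = ldeg b by rewrite /wdeg big_seq1.
apply: homogD; last by rewrite -addrA; apply: homogM => //; apply: homog_letter.
rewrite addrAC skew_letter; apply: homogM => //.
exact/nu2/homog_word.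
Qed.

End SkewTheory.

Definition dminus : disc q -> disc q :=
  skew (fun b => if b then 0 else star z).
Definition dplus : disc q -> disc q :=
  skew (fun b => if b then (q ^+ 2)%:C *: z else 0).

Lemma dminus_ok : skew_ok (fun b => if b then 0 else star z).
Proof.
rewrite /skew_ok mul0r mulr0 add0r addr0 -scalerAr scalerA -rmorphM.
rewrite mulfV ?scale1r //.
by have := qC_neq0; rewrite fmorph_eq0 expf_eq0.
Qed.

Lemma dplus_ok : skew_ok (fun b => if b then (q ^+ 2)%:C *: z else 0).
Proof. by rewrite /skew_ok mul0r mulr0 add0r addr0 -scalerAl -!scalerAr. Qed.

Lemma dminus_z : dminus z = star z.
Proof. exact: (skew_letter dminus_ok false). Qed.

Lemma dminus_z' : dminus (star z) = 0.
Proof. exact: (skew_letter dminus_ok true). Qed.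

Lemma dplus_z : dplus z = 0.
Proof. exact: (skew_letter dplus_ok false). Qed.

Lemma dplus_z' : dplus (star z) = (q ^+ 2)%:C *: z.
Proof. exact: (skew_letter dplus_ok true). Qed.

Lemma dminusM a b : dminus (a * b) = dminus a * nu (nu b) + a * dminus b.
Proof. exact: skewM dminus_ok a b. Qed.

Lemma dplusM a b : dplus (a * b) = dplus a * nu (nu b) + a * dplus b.
Proof. exact: skewM dplus_ok a b. Qed.

Lemma dminus_homog n a : homog n a -> homog (n - 2) (dminus a).
Proof.
apply: (skew_homog dminus_ok) => -[]; first exact: homog0.
exact: (homog_letter q true).
Qed.

Lemma dplus_homog n a : homog n a -> homog (n + 2) (dplus a).
Proof.
apply: (skew_homog dplus_ok) => -[]; last exact: homog0.
exact/homogZ/(homog_letter q false).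
Qed.

End Twist.

Section Cone.
Variables (R : realType) (q : R) (N : nat).
Local Notation C := R[i].
Local Notation "r %:C" := (real_complex R r).

Variant cone_gen := ConeY | ConeX.
Local Notation ty := (TGen ConeY false).
Local Notation ty' := (TGen ConeY true).
Local Notation tx := (TGen ConeX false).
Local Notation tx' := (TGen ConeX true).

Variant cone_rel : term C cone_gen -> term C cone_gen -> Prop :=
  | ConeSelfAdjoint : cone_rel tx' tx
  | ConeCommute :
      cone_rel (TMul tx ty) (TMul (TConst (q ^+ (2 * N))%:C) (TMul ty tx))
  | ConeYY' :
      cone_rel (TMul ty ty')
        (tprod [seq tsub (TConst 1) (TMul (TConst (q ^- (2 * l))%:C) tx)
              | l <- iota 0 N])
  | ConeY'Y :
      cone_rel (TMul ty' ty)
        (tprod [seq tsub (TConst 1) (TMul (TConst (q ^+ (2 * l))%:C) tx)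
              | l <- iota 1 N]).

Lemma cone_star_teval (B : starAlgType C) (f : cone_gen -> B) :
  let x := f ConeX in let y := f ConeY in
  star x = x -> x * y = (q ^+ (2 * N))%:C *: (y * x) ->
  y * star y = \prod_(l <- iota 0 N) (1 - (q ^- (2 * l))%:C *: x) ->
  star y * y = \prod_(l <- iota 1 N) (1 - (q ^+ (2 * l))%:C *: x) ->
  (forall s t, cone_rel s t ->
     teval (star_letters f) s = teval (star_letters f) t) /\
  (forall s t, cone_rel s t ->
     teval (star_letters f) (tstar s) = teval (star_letters f) (tstar t)).
Proof.
move=> x y xx xy yy' y'y.
suff gr s t : cone_rel s t ->
    teval (star_letters f) s = teval (star_letters f) t.
  by split=> // s t st; rewrite !teval_star (gr s t st).
have sub c : teval (star_letters f) (tsub (TConst 1) (TMul (TConst c) tx)) =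
    1 - c *: x.
  by rewrite teval_sub /= scale1r -scalerAl mul1r.
case.
- exact: xx.
- by rewrite /= -scalerAl mul1r.
- rewrite teval_prod big_map [LHS]yy'.
  by apply: eq_bigr => l _; rewrite sub.
- rewrite teval_prod big_map [LHS]y'y.
  by apply: eq_bigr => l _; rewrite sub.
Qed.

End Cone.

Section ConsistentCone.
Variables (R : realType) (q : R) (N : nat).
Local Notation C := R[i].

Lemma cone_consistent : ~ cong (cone_rel q N) (TConst 1) (TConst 0).
Proof.
pose g (x : cone_gen) (_ : bool) : C^o := if x is ConeY then 1 else 0.
have sub b c : teval g (tsub (TConst 1) (TMul (TConst c) (TGen ConeX b))) = 1.
  by rewrite teval_sub /= mulr0 subr0 scale1r.
have star_prod s :
    teval g (tstar (tprod s)) = teval g (tprod (map (@tstar _ _) s)).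
  elim: s => [|t s IHs] /=; first by rewrite rmorph1.
  by rewrite IHs mulrC.
have gr s t : cone_rel q N s t -> teval g s = teval g t.
  case; rewrite ?teval_prod ?big_map //.
  - by rewrite /= !(mulr0, mul0r).
  - by rewrite [LHS]mulr1 big1 // => l _; apply: sub.
  - by rewrite [LHS]mulr1 big1 // => l _; apply: sub.
have gr' s t : cone_rel q N s t -> teval g (tstar s) = teval g (tstar t).
  have sub' c :
      teval g (tstar (tsub (TConst 1) (TMul (TConst c) (TGen ConeX false)))) = 1.
    by rewrite /= !mul0r addr0 rmorph1 scale1r.
  case; rewrite ?star_prod ?teval_prod ?big_map //.
  - by rewrite /= !(mulr0, mul0r).
  - by rewrite [LHS]mulr1 big1 // => l _; apply: sub'.
  - by rewrite [LHS]mulr1 big1 // => l _; apply: sub'.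
move=> /(teval_cong gr gr') /=; rewrite scale1r scale0r.
by move/eqP; rewrite oner_eq0.
Qed.

Definition cone_presentation := Presentation cone_consistent.
Definition cone := presented cone_presentation.
HB.instance Definition _ := StarAlgebra.on cone.

Definition conex : cone := gen (ConeX : gens cone_presentation).
Definition coney : cone := gen (ConeY : gens cone_presentation).

End ConsistentCone.

Section Embedding.
Variables (R : realType) (q : R) (hq : 0 < q < 1) (N : nat).
Local Notation C := R[i].
Local Notation "r %:C" := (real_complex R r).
Local Notation z := (disc_z q).

Let x : disc q := 1 - z * star z.

Lemma q_neq0 : q != 0.
Proof. by case/andP: hq => q0 _; rewrite gt_eqF. Qed.

Lemma star_x : star x = x.
Proof. by rewrite starB star1 starM starK. Qed.

Lemma z'z : star z * z = 1 - (q ^+ 2)%:C *: x.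
Proof.
move/eqP: (disc_eq q); rewrite subr_eq => /eqP ->.
rewrite rmorphB rmorph1 scalerBl scale1r scalerBr.
by rewrite opprB addrA addrAC.
Qed.

Lemma xz n : x * z ^+ n = (q ^+ (2 * n))%:C *: (z ^+ n * x).
Proof.
have xz1 : x * z = (q ^+ 2)%:C *: (z * x).
  rewrite mulrBl mul1r -mulrA z'z mulrBr mulr1 -scalerAr.
  by rewrite opprB addrCA subrr addr0.
elim: n => [|n IHn]; first by rewrite muln0 !expr0 mulr1 mul1r rmorph1 scale1r.
rewrite exprS mulrA xz1 -scalerAl -[z * x * _]mulrA IHn -scalerAr scalerA mulrA.
by rewrite -rmorphM -exprD mulnS.
Qed.

Lemma xz' n : x * star z ^+ n = (q ^- (2 * n))%:C *: (star z ^+ n * x).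
Proof.
have := congr1 star (xz n); rewrite starM starZ starM starX star_x conj_real.
move=> ->; rewrite scalerA -rmorphM mulVf ?rmorph1 ?scale1r //.
by rewrite expf_neq0 // q_neq0.
Qed.

Lemma zz'X n :
  z ^+ n * star (z ^+ n) = \prod_(l <- iota 0 n) (1 - (q ^- (2 * l))%:C *: x).
Proof.
elim: n => [|n IHn]; first by rewrite big_nil star1 mulr1.
rewrite -[X in iota 0 X]addn1 iotaD big_cat big_seq1 add0n /= -IHn.
rewrite exprSr starM starX mulrA -[_ * z * star z]mulrA.
have -> : z * star z = 1 - x by rewrite opprB addrCA subrr addr0.
rewrite -[z ^+ n * _ * _]mulrA -[RHS]mulrA; congr (_ * _).
by rewrite [RHS]mulrBr mulr1 [LHS]mulrBl mul1r xz' -scalerAr.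
Qed.

Lemma z'zX n :
  star (z ^+ n) * z ^+ n = \prod_(l <- iota 1 n) (1 - (q ^+ (2 * l))%:C *: x).
Proof.
elim: n => [|n IHn]; first by rewrite big_nil star1 mulr1.
rewrite -[X in iota 1 X]addn1 iotaD big_cat big_seq1 add1n /= -IHn.
rewrite exprS starM starX mulrA -[_ * star z * z]mulrA z'z.
rewrite -[_ * z ^+ n]mulrA -[RHS]mulrA; congr (_ * _).
rewrite [RHS]mulrBr mulr1 [LHS]mulrBl mul1r -scalerAl xz -scalerAr scalerA.
by rewrite -rmorphM -exprD mulnS.
Qed.


End Embedding.

Section EmbedDef.
Variables (R : realType) (q : R) (hq : 0 < q < 1) (N : nat).
Local Notation C := R[i].
Local Notation "r %:C" := (real_complex R r).
Local Notation z := (disc_z q).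

Definition embed_gen (g : gens (cone_presentation q N)) : disc q :=
  match g with ConeY => z ^+ N | ConeX => 1 - z * star z end.

Lemma embed_rels :
  (forall s t, cone_rel q N s t ->
     teval (star_letters embed_gen) s = teval (star_letters embed_gen) t) /\
  (forall s t, cone_rel q N s t ->
     teval (star_letters embed_gen) (tstar s) =
     teval (star_letters embed_gen) (tstar t)).
Proof.
apply: (@cone_star_teval R q N (disc q) embed_gen).
- exact: star_x.
- exact: xz.
- exact: zz'X.
- exact: z'zX.
Qed.

(* The *-homomorphism x |-> 1 - z z^*, y |-> z^N. *)
Definition embed : cone q N -> disc q := lift (star_letters embed_gen).

Lemma embed_cls t : embed (cls t) = teval (star_letters embed_gen) t.
Proof. by apply: lift_cls; case: embed_rels. Qed.

Lemma embedD : {morph embed : a b / a + b}.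
Proof. by apply: liftD; case: embed_rels. Qed.

Lemma embedM : {morph embed : a b / a * b}.
Proof. by apply: liftM; case: embed_rels. Qed.

Lemma embedZ (c : C) a : embed (c *: a) = c *: embed a.
Proof. by apply: liftZ; case: embed_rels. Qed.

Lemma embed1 : embed 1 = 1.
Proof. by apply: lift1; case: embed_rels. Qed.

Lemma embed_star a : embed (star a) = star (embed a).
Proof.
by elim/clsW: a => t; rewrite [star _]pstarE !embed_cls teval_star.
Qed.

Lemma embed_x : embed (conex q N) = 1 - z * star z.
Proof. by apply: lift_gen; case: embed_rels. Qed.

Lemma embed_y : embed (coney q N) = z ^+ N.
Proof. by apply: lift_gen; case: embed_rels. Qed.

(* The sum over n of the components of degree n N + k. *)
Definition Hspace (k : int) : set (disc q) :=
  sum_of (fun n => @homog R q (n * N%:Z + k)).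

Lemma Hspace0 k : Hspace k 0.
Proof. exact: sum_of0. Qed.

Lemma HspaceD k a b : Hspace k a -> Hspace k b -> Hspace k (a + b).
Proof. exact: sum_ofD. Qed.

Lemma Hspace_map k l (f : disc q -> disc q) :
  f 0 = 0 -> {morph f : a b / a + b} ->
  (forall n a, homog n a -> homog (n + l) (f a)) ->
  forall a, Hspace k a -> Hspace (k + l) (f a).
Proof.
move=> f0 fD fh; apply: sum_of_map => // n a /fh.
by rewrite -addrA; apply: (@sum_of_in _ _ _ n).
Qed.

Lemma HspaceZ k (c : C) a : Hspace k a -> Hspace k (c *: a).
Proof.
rewrite -{2}[k]addr0; apply: (@Hspace_map k 0 (fun a => c *: a)).
- exact: scaler0.
- exact: scalerDr.
- by move=> n b; rewrite addr0; apply: homogZ.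
Qed.

Lemma HspaceM k l a b : Hspace k a -> Hspace l b -> Hspace (k + l) (a * b).
Proof.
move=> ha hb; apply: (@sum_of_map _ _ _ _ (fun a => a * b) _ _ _ a ha).
- exact: mul0r.
- by move=> c d; rewrite mulrDl.
move=> n {ha}a ha; apply: (@sum_of_map _ _ _ _ (fun b => a * b) _ _ _ b hb).
- exact: mulr0.
- by move=> c d; rewrite mulrDr.
move=> m {hb}b hb; apply: (@sum_of_in _ _ _ (n + m)).
by rewrite mulrDl addrACA; apply: homogM.
Qed.

Lemma Hspace_star k a : Hspace k a -> Hspace (- k) (star a).
Proof.
apply: sum_of_map => [||n b /homog_star hb]; [exact: star0|exact: starD|].
by apply: (@sum_of_in _ _ _ (- n)); rewrite mulNr -opprD.
Qed.

Lemma Hspace_nu k a : Hspace k a -> Hspace k (nu a).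
Proof.
rewrite -{2}[k]addr0; apply: Hspace_map; [exact: nu0|exact: nuD|].
by move=> n b hb; rewrite addr0 (nu_homog hq hb); apply: homogZ.
Qed.

Lemma Hspace_homog n k a : homog (n * N%:Z + k) a -> Hspace k a.
Proof. exact: (@sum_of_in _ _ _ n). Qed.

Lemma Hspace1 : Hspace 0 1.
Proof. by apply: (@Hspace_homog 0); rewrite mul0r; apply: homog1. Qed.

Lemma Hspace_embed a : Hspace 0 (embed a).
Proof.
elim/clsW: a => t; rewrite embed_cls.
elim: t => [x b|c|s IHs t IHt|s IHs t IHt] /=.
- suff h : Hspace 0 (embed_gen x).
    by case: b => //=; rewrite -oppr0; apply: Hspace_star.
  have hz : homog 1 z by exact: (homog_letter q false).
  case: x => /=.
    apply: (@Hspace_homog 1); rewrite mul1r addr0.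
    elim: (N) => [|n IHn]; first by rewrite expr0; apply: homog1.
    by rewrite exprS intS; apply: homogM.
  apply: HspaceD; first exact: Hspace1.
  rewrite -scaleN1r; apply: HspaceZ.
  apply: (@Hspace_homog 0); rewrite mul0r addr0.
  by rewrite -(subrr 1); apply/homogM/homog_star.
- exact/HspaceZ/Hspace1.
- exact: HspaceD.
- by rewrite -(addr0 0); apply: HspaceM.
Qed.

(* The subspace [Hspace k] as a vector space. *)
Record Hpart (k : int) := HPart {
  hval :> disc q;
  hvalP : hval \in Hspace k
}.

HB.instance Definition _ k := [isSub for @hval k].
HB.instance Definition _ k := [Choice of Hpart k by <:].

Lemma Hspace_submod k : GRing.subsemimod_closed (mem (Hspace k)).
Proof.
split; [split|] => [|a b|c a]; rewrite !inE; last exact: HspaceZ.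
  exact: Hspace0.
exact: HspaceD.
Qed.

HB.instance Definition _ k := GRing.SubChoice_isSubLmodule.Build C (disc q)
  (mem (Hspace k)) (Hpart k) (Hspace_submod k).

(* H = H_+ (+) H_-, with H_+ = Hpart 1 and H_- = Hpart (-1). *)
Definition Hcone : lmodType C := (Hpart 1 * Hpart (-1))%type.

Definition hmap k l (f : disc q -> disc q)
  (fh : forall a, Hspace k a -> Hspace l (f a)) (h : Hpart k) : Hpart l :=
  @HPart l (f (hval h)) (mem_set (fh _ (set_mem (hvalP h)))).

Lemma Hspace_nu2M k (a : cone q N) (h : disc q) :
  Hspace k h -> Hspace k (nu (nu (embed a)) * h).
Proof.
by rewrite -{2}[k]add0r; apply/HspaceM/Hspace_nu/Hspace_nu/Hspace_embed.
Qed.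

Lemma Hspace_dminus a : Hspace 1 a -> Hspace (-1) (dminus a).
Proof.
apply: (@Hspace_map 1 (-2)) => [||n b]; last exact: dminus_homog.
  exact/skew0/dminus_ok.
exact/skewD/dminus_ok.
Qed.

Lemma Hspace_dplus a : Hspace (-1) a -> Hspace 1 (dplus a).
Proof.
apply: (@Hspace_map (-1) 2) => [||n b]; last exact: dplus_homog.
  exact/skew0/dplus_ok.
exact/skewD/dplus_ok.
Qed.

Lemma Hspace_starN a : Hspace (-1) a -> Hspace 1 (star a).
Proof. by move/Hspace_star; rewrite opprK. Qed.

Definition pi_H (a : cone q N) (h : Hcone) : Hcone :=
  (hmap (@Hspace_nu2M 1 a) h.1, hmap (@Hspace_nu2M (-1) a) h.2).

Definition nu_H (h : Hcone) : Hcone :=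
  (hmap (@Hspace_nu 1) h.1, hmap (@Hspace_nu (-1)) h.2).

Definition D_H (h : Hcone) : Hcone :=
  (- (q^-1)%:C *: hmap Hspace_dplus h.2, q%:C *: hmap Hspace_dminus h.1).

Definition J_H (h : Hcone) : Hcone :=
  (- hmap Hspace_starN h.2, hmap (@Hspace_star 1) h.1).

Definition gamma_H (h : Hcone) : Hcone := (h.1, - h.2).

End EmbedDef.

Arguments pi_H {R q} hq N a h.
Arguments nu_H {R q} hq N h.
Arguments D_H {R q} hq N h.
Arguments J_H {R} q N h.
Arguments gamma_H {R} q N h.

Variant sign := Plus | Minus.

Section TwistedTriple.
Variables (C : numClosedFieldType) (A : starAlgType C) (H : lmodType C).

Definition sgn (e : sign) : C := if e is Plus then 1 else -1.

(* The inverse of f when f is bijective, as are nu (by [twist_bij]) and J (by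
   [real_square]). *)
Definition funinv (f : H -> H) : H -> H :=
  fun y => xget 0 [set x | f x = y]%classic.

Definition commutator (f g : H -> H) : H -> H := fun h => f (g h) - g (f h).

(* nu-bar *)
Definition conj_by (nu phi : H -> H) : H -> H := nu \o phi \o funinv nu.

Record is_representation (pi : A -> H -> H) : Prop := {
  rep_linear : forall a, linear (pi a);
  rep_linear_alg : forall h, linear (pi^~ h);
  rep1 : pi 1 =1 id;
  repM : forall a b, pi (a * b) =1 pi a \o pi b
}.

Record is_twist (pi : A -> H -> H) (nu : H -> H) : Prop := {
  twist_linear : linear nu;
  twist_bij : bijective nu;
  twist_lift : exists2 nuA : {lrmorphism A -> A}, bijective nuA
    & forall a, pi (nuA a) =1 conj_by nu (pi a)
}.

Record is_twisted_real_structure (e e' : sign) (pi : A -> H -> H)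
    (D nu J : H -> H) : Prop := {
  real_antilinear : forall (c : C) g h, J (c *: g + h) = c^* *: J g + J h;
  real_square : forall h, J (J h) = sgn e *: h;
  real_order0 : forall a b h, commutator (pi a) (J \o pi b \o funinv J) h = 0;
  real_order1 : forall a b,
    commutator D (pi a) \o (J \o conj_by nu (conj_by nu (pi b)) \o funinv J) =1
    (J \o pi b \o funinv J) \o commutator D (pi a);
  real_dirac : forall h, D (J (nu h)) = sgn e' *: nu (J (D h));
  real_twist : nu \o J \o nu =1 J
}.

Record is_grading (e'' : sign) (pi : A -> H -> H) (D nu J gamma : H -> H) :
    Prop := {
  grading_linear : linear gamma;
  grading_square : involutive gamma;
  grading_rep : forall a h, commutator gamma (pi a) h = 0;
  grading_dirac : forall h, gamma (D h) = - D (gamma h);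
  grading_twist : forall h, nu (nu (gamma h)) = gamma (nu (nu h));
  grading_real : forall h, gamma (J h) = sgn e'' *: J (gamma h)
}.

(* The even case of the usual table: the signs of J^2, of D J nu = +- nu J D and
   of gamma J = +- J gamma in KO-dimension two. *)
Definition KO_dimension_two (e e' e'' : sign) : Prop :=
  (e, e', e'') = (Minus, Plus, Minus).

Definition even_real_triple_of_KO_dimension_two (pi : A -> H -> H)
    (D nu J gamma : H -> H) : Prop :=
  [/\ is_representation pi, linear D, is_twist pi nu &
   exists e e' e'', [/\ is_twisted_real_structure e e' pi D nu J,
     is_grading e'' pi D nu J gamma & KO_dimension_two e e' e'']].

End TwistedTriple.


Arguments even_real_triple_of_KO_dimension_two {C} A H pi D nu J gamma.

(* Main.v *)
(* The proposition comes down to three identities in the disc algebra,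
     nu(nu(a)^* ) = a^*,   d_-(nu(a)) = q^2 nu(d_-(a)),
     d_+(a^* ) = nu^2(d_-(a)^* ),
   the last two also with + and - exchanged (and q^-2 in place of q^2).
   The first is nu J nu = J, and the other two give D J nu = nu J D.
   J pi(b) J^-1 is right multiplication by nu^2(b)^*, so it commutes with pi,
   which acts on the left.  By the twisted Leibniz rule [D, pi(a)] sends h to
   d(nu^2(a)) nu^2(h), and the nu^2 applied to h is exactly what the twist by
   nu-bar^2 in the first-order condition compensates.  On the cone, nu rescales
   y by q^N and fixes x, so it lifts to an automorphism of the cone itself. *)
Require Import Defs.
From HB Require Import structures.
From mathcomp Require Import all_boot all_order all_algebra.
From mathcomp Require Import complex.
From mathcomp Require Import boolp classical_sets reals.

Set Implicit Arguments.
Unset Strict Implicit.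
Unset Printing Implicit Defensive.
Import Order.TTheory GRing.Theory Num.Theory.
Local Open Scope ring_scope.

(** * Commutation of [nu], the involution and the skew derivations on the disc *)

Section DiscIdentities.
Variables (R : realType) (q : R) (hq : 0 < q < 1).
Local Notation C := R[i].
Local Notation "r %:C" := (real_complex R r).

Let q_unit : q \is a GRing.unit.
Proof. by rewrite unitfE q_neq0. Qed.

Lemma nuN (a : disc q) : nu (- a) = - nu a.
Proof. by rewrite -scaleN1r nuZ // scaleN1r. Qed.

(** The involution negates degrees and q is real, so the factors q^n and q^-n from the two uses of
    [nu] cancel. *)
Lemma star_nu (a : disc q) : nu (star (nu a)) = star a.
Proof.
elim/disc_ind: a => [|||a b IHa IHb|a b IHa IHb].
- rewrite nu_z // starZ conj_real nuZ // nu_z' // scalerA -rmorphM divrr //.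
  by rewrite scale1r.
- rewrite nu_z' // starZ conj_real nuZ // starK nu_z // scalerA -rmorphM.
  by rewrite mulVr // scale1r.
- by move=> c; rewrite nu_const // starZ star1 nu_const.
- by rewrite nuD // !starD nuD // IHa IHb.
- by rewrite nuM // !starM nuM // IHa IHb.
Qed.

Lemma dminusD : {morph @dminus R q : a b / a + b}.
Proof. exact/skewD/dminus_ok. Qed.

Lemma dplusD : {morph @dplus R q : a b / a + b}.
Proof. exact/skewD/dplus_ok. Qed.

Lemma dminusZ (c : C) (a : disc q) : dminus (c *: a) = c *: dminus a.
Proof. exact/skewZ/dminus_ok. Qed.

Lemma dplusZ (c : C) (a : disc q) : dplus (c *: a) = c *: dplus a.
Proof. exact/skewZ/dplus_ok. Qed.

(** Since [nu] is multiplicative, both sides satisfy the same twisted Leibniz rule, and the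
    generators decide. For d of degree e the constant is q^-e. *)
Lemma skew_nu (d : bool -> disc q) (c : C) : skew_ok d ->
  (forall b, Defs.skew d (nu (letter q b)) = c *: nu (d b)) ->
  forall a, Defs.skew d (nu a) = c *: nu (Defs.skew d a).
Proof.
move=> dok dE; elim/disc_ind=> [|||a b IHa IHb|a b IHa IHb].
- by rewrite (dE false) -(skew_letter hq dok false).
- by rewrite (dE true) -(skew_letter hq dok true).
- by move=> c'; rewrite nu_const // !skew_const // nu0 // scaler0.
- by rewrite nuD // !skewD // nuD // scalerDr IHa IHb.
- rewrite nuM // !skewM // nuD // !nuM // IHa IHb scalerDr.
  by rewrite -scalerAl -scalerAr.
Qed.

Lemma dminus_nu (a : disc q) : dminus (nu a) = (q ^+ 2)%:C *: nu (dminus a).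
Proof.
apply: (skew_nu (dminus_ok hq)) => b; rewrite -[LHS]/(dminus _).
case: b => /=.
  by rewrite nu_z' // dminusZ dminus_z' // nu0 // !scaler0.
rewrite nu_z // dminusZ dminus_z // nu_z' // scalerA -rmorphM.
by rewrite expr2 mulrK.
Qed.

Lemma dplus_nu (a : disc q) : dplus (nu a) = (q ^- 2)%:C *: nu (dplus a).
Proof.
apply: (skew_nu (dplus_ok q)) => b; rewrite -[LHS]/(dplus _).
case: b => /=.
  rewrite nu_z' // dplusZ dplus_z' // nuZ // nu_z // !scalerA -!rmorphM.
  by rewrite [q ^- 2 * _]mulVr ?unitrX // mul1r expr2 mulKr.
by rewrite nu_z // dplusZ dplus_z // nu0 // !scaler0.
Qed.

(** The involution reverses products, which puts the twist of the Leibniz rule on the wrong factor;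
    the outer nu^2 removes it there, by [star_nu], and supplies it to the other factor. *)
Lemma dplus_star (a : disc q) : dplus (star a) = nu (nu (star (dminus a))).
Proof.
elim/disc_ind: a => [|||a b IHa IHb|a b IHa IHb].
- by rewrite dplus_z' // dminus_z // starK nu2_z.
- by rewrite starK dplus_z // dminus_z' // star0 !nu0.
- move=> c; rewrite starZ star1 [LHS](skew_const hq (dplus_ok q)).
  by rewrite [dminus _](skew_const hq (dminus_ok hq)) star0 !nu0.
- by rewrite starD dplusD dminusD starD !nuD // IHa IHb.
- rewrite starM dplusM // dminusM // starD !starM !(nuD, nuM) //.
  by rewrite IHa IHb !star_nu addrC.
Qed.

Lemma dminus_star (a : disc q) : dminus (star a) = nu (nu (star (dplus a))).
Proof.
by rewrite -{2}[a]starK dplus_star !star_nu starK.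
Qed.

End DiscIdentities.

(** * Rescaling automorphisms of the cone and the lift of [nu] *)

Section ConeScaling.
Variables (R : realType) (q : R) (N : nat).
Local Notation C := R[i].
Local Notation gen_type := (gens (cone_presentation q N)).

(** Weight n corresponds to degree n N in the disc. This is a relation rather than a function
    because an expression need not be homogeneous. *)
Inductive weighted : int -> term C gen_type -> Prop :=
  | weighted_y : weighted 1 (TGen ConeY false)
  | weighted_y' : weighted (-1) (TGen ConeY true)
  | weighted_x b : weighted 0 (TGen ConeX b)
  | weighted_const c : weighted 0 (TConst c)
  | weighted_add n s t : weighted n s -> weighted n t -> weighted n (TAdd s t)
  | weighted_mul m n s t :
      weighted m s -> weighted n t -> weighted (m + n) (TMul s t).

Lemma weighted_mul0l n s t :
  weighted 0 s -> weighted n t -> weighted n (TMul s t).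
Proof. by move=> s0 /(weighted_mul s0); rewrite add0r. Qed.

Lemma weighted_tstar n t : weighted n t -> weighted (- n) (tstar t).
Proof.
elim=> {n t} [||b|c|n s t _ IHs _ IHt|m n s t _ IHs _ IHt] /=.
- exact: weighted_y'.
- by rewrite opprK; apply: weighted_y.
- by rewrite oppr0; apply: weighted_x.
- by rewrite oppr0; apply: weighted_const.
- exact: weighted_add.
- by rewrite opprD addrC; apply: weighted_mul.
Qed.

Lemma cone_rel_weighted s t :
  cone_rel q N s t -> exists2 n, weighted n s & weighted n t.
Proof.
(* Both products in the relations are polynomials in x. *)
have tprod0 (c : nat -> C) r :
    weighted 0 (tprod [seq tsub (TConst 1) (TMul (TConst (c l))
      (TGen (ConeX : gen_type) false)) | l <- r]).
  elim: r => [|l r IHr]; first exact: weighted_const.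
  apply: weighted_mul0l IHr.
  apply: weighted_add; first exact: weighted_const.
  do 2!apply: weighted_mul0l (weighted_const _) _.
  exact: weighted_x.
case=> [|||].
- by exists 0; apply: weighted_x.
- exists 1; first by apply: weighted_mul0l weighted_y; apply: weighted_x.
  apply: weighted_mul0l (weighted_const _) _; rewrite -[1]addr0.
  exact: weighted_mul weighted_y (weighted_x _).
- exists 0; last exact: tprod0.
  by rewrite -(subrr 1); apply: weighted_mul weighted_y weighted_y'.
- exists 0; last exact: tprod0.
  by rewrite -(addNr 1); apply: weighted_mul weighted_y' weighted_y.
Qed.

Section Scalar.
Variables (u : C) (u0 : u != 0).

(** The map need not respect the involution, so y^* gets its own image; the factor u^-1 keeps y y^*
    and y^* y, which are polynomials in x, fixed. *)
Definition scale_letter (g : gen_type) (b : bool) : cone q N :=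
  match g with
  | ConeY => u ^ (if b then -1 else 1 : int) *: cls (TGen g b)
  | ConeX => cls (TGen g b)
  end.

Lemma scale_weighted n t :
  weighted n t -> teval scale_letter t = u ^ n *: cls t.
Proof.
elim=> {n t} [||b|c|n s t _ IHs _ IHt|m n s t _ IHs _ IHt] //=.
- by rewrite scale1r.
- by rewrite scale1r cls_const.
- by rewrite IHs IHt clsD scalerDr.
- by rewrite IHs IHt clsM expfzDr // -scalerAl -scalerAr scalerA.
Qed.

(** The two sides of a relation share a weight n, so both are multiplied by u^n, and by u^-n after
    the involution. *)
Lemma scale_rels :
  (forall s t, cone_rel q N s t ->
     teval scale_letter s = teval scale_letter t) /\
  (forall s t, cone_rel q N s t ->
     teval scale_letter (tstar s) = teval scale_letter (tstar t)).
Proof.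
split=> s t st; have [n ns nt] := cone_rel_weighted st.
  rewrite (scale_weighted ns) (scale_weighted nt); congr (_ *: _).
  exact/clsP/cong_rel.
rewrite (scale_weighted (weighted_tstar ns)).
rewrite (scale_weighted (weighted_tstar nt)).
by congr (_ *: _); apply/clsP/cong_rel_star.
Qed.

Definition cone_scale : cone q N -> cone q N := Defs.lift scale_letter.

Lemma cone_scale_cls t : cone_scale (cls t) = teval scale_letter t.
Proof. by apply: lift_cls; case: scale_rels. Qed.

Lemma cone_scaleD : {morph cone_scale : a b / a + b}.
Proof. by apply: liftD; case: scale_rels. Qed.

Lemma cone_scaleM : {morph cone_scale : a b / a * b}.
Proof. by apply: liftM; case: scale_rels. Qed.

Lemma cone_scaleZ c a : cone_scale (c *: a) = c *: cone_scale a.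
Proof. by apply: liftZ; case: scale_rels. Qed.

Lemma cone_scale1 : cone_scale 1 = 1.
Proof. by apply: lift1; case: scale_rels. Qed.

(** [twist_lift] asks for a bundled morphism. The bundle needs [u0], which [cone_scale] does not
    carry, so it is packed under that hypothesis. *)
Lemma cone_scale_lrmorphism :
  {f : {lrmorphism cone q N -> cone q N} | f =1 cone_scale}.
Proof.
have lin : linear cone_scale by move=> c a b; rewrite cone_scaleD cone_scaleZ.
pose flin := GRing.isLinear.Build _ _ _ _ _ lin.
pose fmul := GRing.isMonoidMorphism.Build _ _ _ (cone_scale1, cone_scaleM).
by exists
  (HB.pack_for {lrmorphism cone q N -> cone q N} cone_scale flin fmul).
Qed.

End Scalar.

Lemma cone_scaleK (u : C) : u != 0 -> cancel (cone_scale u) (cone_scale u^-1).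
Proof.
move=> u0; have u0' : u^-1 != 0 by rewrite invr_eq0.
elim/clsW=> t; rewrite cone_scale_cls //.
elim: t => [[] b|c|s IHs t IHt|s IHs t IHt].
- rewrite /= cone_scaleZ // cone_scale_cls //=.
  by rewrite scalerA exprz_inv -expfzDr // subrr scale1r.
- by rewrite /= cone_scale_cls.
- by rewrite /= -cls_const cone_scale_cls //= cls_const.
- by rewrite /= cone_scaleD // IHs IHt clsD.
- by rewrite /= cone_scaleM // IHs IHt clsM.
Qed.

Lemma cone_scale_bij (u : C) : u != 0 -> bijective (cone_scale u).
Proof.
move=> u0; exists (cone_scale u^-1); first exact: cone_scaleK.
by rewrite -{2}[u]invrK; apply: cone_scaleK; rewrite invr_eq0.
Qed.

Lemma embed_scale (hq : 0 < q < 1) (a : cone q N) :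
  embed (cone_scale (real_complex R (q ^+ N)) a) = nu (embed a).
Proof.
set u := real_complex R (q ^+ N).
have u0 : u != 0 by rewrite fmorph_eq0 expf_neq0 // q_neq0.
have nuzN : nu (disc_z q ^+ N) = u *: disc_z q ^+ N.
  rewrite /u; elim: (N) => [|n IHn]; first by rewrite !expr0 nu1 ?scale1r.
  by rewrite !exprS nuM // IHn nu_z // -scalerAl -scalerAr scalerA -rmorphM.
(* Since u is real, u (z^N)^* = nu(z^N)^*, whose image under [nu] is (z^N)^* by [star_nu]. *)
have nuzN' : nu (star (disc_z q ^+ N)) = u^-1 *: star (disc_z q ^+ N).
  have conju : u^* = u by apply: conj_real.
  rewrite -[LHS]scale1r -{1}(mulVf u0) -scalerA -nuZ //.
  by rewrite -{2}conju -starZ -nuzN star_nu.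
have nux : nu (1 - disc_z q * star (disc_z q)) = 1 - disc_z q * star (disc_z q).
  rewrite nuD // nu1 // -scaleN1r nuZ //; congr (_ + _ *: _).
  rewrite nuM // nu_z // nu_z' // -scalerAl -scalerAr scalerA -rmorphM.
  by rewrite divff ?q_neq0 // rmorph1 scale1r.
elim/clsW: a => t; rewrite cone_scale_cls // embed_cls //.
elim: t => [[] b|c|s IHs t IHt|s IHs t IHt] /=.
- by case: b; rewrite embedZ // embed_cls //= (nuzN, nuzN').
- by case: b; rewrite embed_cls //= ?star_x nux.
- by rewrite embedZ // embed1 // nu_const.
- by rewrite embedD // nuD // IHs IHt.
- by rewrite embedM // nuM // IHs IHt.
Qed.

End ConeScaling.

(** [funinv] chooses a preimage, with default 0; a two-sided inverse makes the preimage exist and be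
    unique, so the default never occurs. *)
Lemma funinvE (C : numClosedFieldType) (H : lmodType C) (f g : H -> H) :
  cancel f g -> cancel g f -> funinv f =1 g.
Proof.
move=> fK gK h; apply: (can_inj fK); rewrite gK.
by apply: (xgetPex 0 (P := [set x | f x = h]%classic)); exists (g h).
Qed.

(** * The axioms of the twisted real structure and of the grading on H *)

Section ConeTriple.
Variables (R : realType) (q : R) (hq : 0 < q < 1) (N : nat).
Local Notation C := R[i].
Local Notation "r %:C" := (real_complex R r).
Local Notation H := (Hcone q N).
Local Notation pi := (pi_H hq N).
Local Notation nuH := (nu_H hq N).
Local Notation D := (D_H hq N).
Local Notation J := (J_H q N).
Local Notation gamma := (gamma_H q N).

(** Reduces identities in H to pairs of identities in the disc. The [change] steps below then spell
    out the operations on the subspaces, which are computed in the disc. *)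
Lemma Hcone_eq (g h : H) :
  hval g.1 = hval h.1 -> hval g.2 = hval h.2 -> g = h.
Proof. by case: g h => [g1 g2] [h1 h2] /= /val_inj -> /val_inj ->. Qed.

Lemma pi_H_representation : is_representation pi.
Proof.
split.
- move=> a c g h; apply: Hcone_eq.
    change (nu (nu (embed a)) * (c *: hval g.1 + hval h.1)
      = c *: (nu (nu (embed a)) * hval g.1) + nu (nu (embed a)) * hval h.1).
    by rewrite mulrDr -scalerAr.
  change (nu (nu (embed a)) * (c *: hval g.2 + hval h.2)
    = c *: (nu (nu (embed a)) * hval g.2) + nu (nu (embed a)) * hval h.2).
  by rewrite mulrDr -scalerAr.
- move=> h c a b.
  have E x : nu (nu (embed (c *: a + b))) * x =
      c *: (nu (nu (embed a)) * x) + nu (nu (embed b)) * x.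
    by rewrite embedD // embedZ // !(nuD, nuZ) // mulrDl -scalerAl.
  by apply: Hcone_eq; exact: E.
- by move=> h; apply: Hcone_eq; rewrite /= embed1 // !nu1 // mul1r.
- by move=> a b h; apply: Hcone_eq; rewrite /= embedM // !nuM // mulrA.
Qed.

Lemma D_H_linear : linear D.
Proof.
move=> c g h; apply: Hcone_eq.
  change (- (q^-1)%:C *: dplus (c *: hval g.2 + hval h.2) =
    c *: (- (q^-1)%:C *: dplus (hval g.2)) + - (q^-1)%:C *: dplus (hval h.2)).
  by rewrite dplusD // dplusZ // scalerDr !scalerA mulrC.
change (q%:C *: dminus (c *: hval g.1 + hval h.1) =
  c *: (q%:C *: dminus (hval g.1)) + q%:C *: dminus (hval h.1)).
by rewrite dminusD // dminusZ // scalerDr !scalerA mulrC.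
Qed.

Lemma nu_H_linear : linear nuH.
Proof.
have E c (x y : disc q) : nu (c *: x + y) = c *: nu x + nu y.
  by rewrite nuD // nuZ.
by move=> c g h; apply: Hcone_eq; exact: E.
Qed.

Lemma gamma_H_linear : linear gamma.
Proof.
move=> c g h; apply: Hcone_eq; first by [].
change (- (c *: hval g.2 + hval h.2) = c *: (- hval g.2) + - hval h.2).
by rewrite opprD scalerN.
Qed.

Lemma J_H_antilinear (c : C) g h : J (c *: g + h) = c^* *: J g + J h.
Proof.
apply: Hcone_eq.
  change (- star (c *: hval g.2 + hval h.2) =
    c^* *: (- star (hval g.2)) + - star (hval h.2)).
  by rewrite starD starZ opprD scalerN.
change (star (c *: hval g.1 + hval h.1) =
  c^* *: star (hval g.1) + star (hval h.1)).
by rewrite starD starZ.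
Qed.

Lemma J_HN h : J (- h) = - J h.
Proof.
apply: Hcone_eq; last exact: starN.
by change (- star (- hval h.2) = - - star (hval h.2)); rewrite starN.
Qed.

Lemma J_H_square h : J (J h) = - h.
Proof.
apply: Hcone_eq.
  by change (- star (star (hval h.1)) = - hval h.1); rewrite starK.
by change (star (- star (hval h.2)) = - hval h.2); rewrite starN starK.
Qed.

Lemma J_H_inv : funinv J =1 (fun h => - J h).
Proof.
apply: funinvE => h; first by rewrite J_H_square opprK.
by rewrite J_HN J_H_square opprK.
Qed.

Lemma nu_HN h : nuH (- h) = - nuH h.
Proof.
by apply: Hcone_eq; exact: nuN.
Qed.

Lemma nu_H_twist h : nuH (J (nuH h)) = J h.
Proof.
apply: Hcone_eq; last exact: star_nu.
change (nu (- star (nu (hval h.2))) = - star (hval h.2)).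
by rewrite nuN // star_nu.
Qed.

(* The twist condition nu J nu = J exhibits J^-1 nu J as an inverse of nu. *)
Lemma nu_H_bij : bijective nuH.
Proof.
exists (fun h => - J (nuH (J h))) => h.
  by rewrite nu_H_twist J_H_square opprK.
by rewrite nu_HN nu_H_twist J_H_square opprK.
Qed.

(** An equality of functions rather than a pointwise one, so that [conj_nu_pi_H] can rewrite inside
    a second [conj_by] to reach nu-bar^2. *)
Lemma conj_nu_H (f g : H -> H) :
  (forall h, nuH (f h) = g (nuH h)) -> conj_by nuH f = g.
Proof.
have [nuV nuK nuVK] := nu_H_bij.
move=> fg; apply/funext => h; rewrite /conj_by /= fg; congr g.
by rewrite (funinvE nuK nuVK) nuVK.
Qed.

Lemma conj_nu_pi_H a :
  conj_by nuH (pi a) = pi (cone_scale (q ^+ N)%:C a).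
Proof.
have E (x : disc q) : nu (nu (nu (embed a)) * x) =
    nu (nu (embed (cone_scale (q ^+ N)%:C a))) * nu x.
  by rewrite embed_scale // nuM.
by apply: conj_nu_H => h; apply: Hcone_eq; exact: E.
Qed.

Lemma pi_H_twist : is_twist pi nuH.
Proof.
have u0 : (q ^+ N)%:C != 0 by rewrite fmorph_eq0 expf_neq0 // q_neq0.
split; [exact: nu_H_linear|exact: nu_H_bij|].
have [f fE] := cone_scale_lrmorphism q N u0.
exists f => [|a h]; last by rewrite conj_nu_pi_H fE.
by apply: eq_bij (cone_scale_bij q N u0) _ _ => a; rewrite fE.
Qed.

Lemma JpiJ_fst b h : hval ((J \o pi b \o funinv J) h).1 =
  hval h.1 * star (nu (nu (embed b))).
Proof.
rewrite /= J_H_inv.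
change (- star (nu (nu (embed b)) * (- star (hval h.1))) =
  hval h.1 * star (nu (nu (embed b)))).
by rewrite mulrN starN opprK starM starK.
Qed.

Lemma JpiJ_snd b h : hval ((J \o pi b \o funinv J) h).2 =
  hval h.2 * star (nu (nu (embed b))).
Proof.
rewrite /= J_H_inv.
change (star (nu (nu (embed b)) * (- - star (hval h.2))) =
  hval h.2 * star (nu (nu (embed b)))).
by rewrite opprK starM starK.
Qed.

(** Of the two Leibniz terms, the one that differentiates h is cancelled by pi(a) D. *)
Lemma commutator_D_fst a h : hval (commutator D (pi a) h).1 =
  - (q^-1)%:C *: (dplus (nu (nu (embed a))) * nu (nu (hval h.2))).
Proof.
change (- (q^-1)%:C *: dplus (nu (nu (embed a)) * hval h.2)
  - nu (nu (embed a)) * (- (q^-1)%:C *: dplus (hval h.2)) =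
  - (q^-1)%:C *: (dplus (nu (nu (embed a))) * nu (nu (hval h.2)))).
by rewrite dplusM // scalerDr -scalerAr addrK.
Qed.

Lemma commutator_D_snd a h : hval (commutator D (pi a) h).2 =
  q%:C *: (dminus (nu (nu (embed a))) * nu (nu (hval h.1))).
Proof.
change (q%:C *: dminus (nu (nu (embed a)) * hval h.1)
  - nu (nu (embed a)) * (q%:C *: dminus (hval h.1)) =
  q%:C *: (dminus (nu (nu (embed a))) * nu (nu (hval h.1)))).
by rewrite dminusM // scalerDr -scalerAr addrK.
Qed.

(** The coefficients of D are matched to this: q^2 from [dminus_nu] turns q^-1 into q, and q^-2 from
    [dplus_nu] turns q into q^-1. *)
Lemma J_H_dirac h : D (J (nuH h)) = nuH (J (D h)).
Proof.
have q0 : q != 0 by apply: q_neq0.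
apply: Hcone_eq.
  change (- (q^-1)%:C *: dplus (star (nu (hval h.1))) =
    nu (- star (q%:C *: dminus (hval h.1)))).
  rewrite nuN // dplus_star // dminus_nu // !starZ !conj_real !nuZ //.
  rewrite star_nu // scaleNr scalerA -rmorphM; congr (- (_%:C *: _)).
  by rewrite expr2 mulKf.
change (q%:C *: dminus (- star (nu (hval h.2))) =
  nu (star (- (q^-1)%:C *: dplus (hval h.2)))).
rewrite -scaleN1r dminusZ // dminus_star // dplus_nu // !starZ rmorphN /=.
rewrite !conj_real !nuZ // star_nu // !scaleNr scale1r scalerN scalerA.
by rewrite -rmorphM; congr (- (_%:C *: _)); rewrite expr2 invfM mulVKf.
Qed.

Lemma J_H_real_structure :
  is_twisted_real_structure Minus Plus pi D nuH J.
Proof.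
split.
- exact: J_H_antilinear.
- by move=> h; rewrite J_H_square scaleN1r.
- move=> a b h; apply/eqP; rewrite subr_eq0; apply/eqP.
  apply: Hcone_eq; rewrite [RHS](JpiJ_fst, JpiJ_snd) -[RHS]mulrA; congr (_ * _).
    exact: JpiJ_fst.
  exact: JpiJ_snd.
(* The twist by nu-bar^2 makes the right factor nu^4(b)^*, and the nu^2 left by the Leibniz rule
   turns it into nu^2(b)^*. The components cross because D exchanges H_+ and H_-. *)
- move=> a b h; rewrite !conj_nu_pi_H.
  apply: Hcone_eq.
    rewrite [LHS]commutator_D_fst JpiJ_snd [RHS]JpiJ_fst commutator_D_fst.
    by rewrite !embed_scale // -scalerAl !nuM // !star_nu // mulrA.
  rewrite [LHS]commutator_D_snd JpiJ_fst [RHS]JpiJ_snd commutator_D_snd.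
  by rewrite !embed_scale // -scalerAl !nuM // !star_nu // mulrA.
- by move=> h; rewrite J_H_dirac scale1r.
- exact: nu_H_twist.
Qed.

Lemma gamma_H_grading : is_grading Minus pi D nuH J gamma.
Proof.
split.
- exact: gamma_H_linear.
- by move=> [h1 h2]; rewrite /gamma_H /= opprK.
- move=> a h; apply/eqP; rewrite subr_eq0; apply/eqP.
  apply: Hcone_eq; first by [].
  change (- (nu (nu (embed a)) * hval h.2) = nu (nu (embed a)) * (- hval h.2)).
  by rewrite mulrN.
- move=> h; apply: Hcone_eq; last by [].
  change (- (q^-1)%:C *: dplus (hval h.2) =
    - (- (q^-1)%:C *: dplus (- hval h.2))).
  by rewrite -[- hval _]scaleN1r dplusZ // scaleN1r scalerN opprK.
- move=> h; apply: Hcone_eq; first by [].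
  change (nu (nu (- hval h.2)) = - nu (nu (hval h.2))).
  by rewrite !nuN.
- move=> h; rewrite scaleN1r; apply: Hcone_eq; last by [].
  change (- star (hval h.2) = - - star (- hval h.2)).
  by rewrite starN opprK.
Qed.

End ConeTriple.

Theorem proposition3p4 (R : realType) (q : R) (hq : 0 < q < 1)
    (N : nat) (hN : (1 < N)%N) :
  even_real_triple_of_KO_dimension_two (C := R[i]) (cone q N) (Hcone q N)
    (pi_H hq N) (D_H hq N) (nu_H hq N) (J_H q N) (gamma_H q N).
Proof.
split.
- exact: pi_H_representation.
- exact: D_H_linear.
- exact: pi_H_twist.
- exists Minus, Plus, Minus; split=> //.
    exact: J_H_real_structure.
  exact: gamma_H_grading.
Qed.
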